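(* Let $n\ge 2$ be an integer such that $A_n=\{d : d\mid n,\ 1<d<\sqrt{n}\}$ is in arithmetic progression. Then $|A_n|\le 5$. In addition, one of the following is true, where $p$, $q$, $r$ denote distinct prime numbers: (i) $n=p$ or $n=p^2$ for some $p$, hence $A_n=\emptyset$; (ii) $n=pq$ for some $p<q$, hence $A_n=\{p\}$; (iii) $n=p^3$ or $n=p^4$ for some $p$, hence $A_n=\{p\}$; (iv) $n=p^5$ for some $p$, hence $A_n=\{p,p^2\}$; (v) $n=pq^2$, where $p<q$, hence $A_n=\{p,q\}$; (vi) $n=p^2q$, where $p^2<q$, hence $A_n=\{p,p^2\}$; (vii) $n=p^2q$, where $p<q<p^2$, hence $A_n=\{p,q\}$; (viii) $n=p^6$ for some $p$, hence $A_n=\{p,p^2\}$; (ix) $n=36$, hence $A_n=\{2,3,4\}$; (x) $n=pqr$, where $p<q<r$ are such that $2q=p+r$, hence $A_n=\{p,q,r\}$; (xi) $n=24$, hence $A_n=\{2,3,4\}$; (xii) $n=60$, hence $A_n=\{2,3,4,5,6\}$.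
   Context: For a positive integer $n$, $A_n$ is the set of positive divisors $d$ of $n$ with $1<d<\sqrt{n}$ (both inequalities strict). $A_n$ is said to be in arithmetic progression if, with $k=|A_n|$, its elements are $d, d+a, d+2a,\ldots,d+(k-1)a$ for some first term $d$ and common difference $a>0$; sets with $k=0$ or $k=1$ elements are vacuously in arithmetic progression. *)

(* Defs.v *)
From mathcomp Require Import all_boot all_order all_algebra all_field.
From mathcomp Require Import finmap.

Set Implicit Arguments.
Unset Strict Implicit.
Unset Printing Implicit Defensive.

Import Order.TTheory GRing.Theory Num.Theory.

Local Open Scope fset_scope.
Local Open Scope nat_scope.

(* The square root is taken in algC, where sqrtC n%:R is the nonnegative
   real square root; see ltn_sqrtC for the equivalent test on nat. *)
Definition small_divisors (n : nat) : {fset nat} :=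
  [fset d in divisors n | (1 < d) && (d%:R < sqrtC (n%:R : algC))%R].

(* Sets with at most one element qualify: see in_arith_progression_small. *)
Definition in_arith_progression (S : {fset nat}) : Prop :=
  exists d a : nat,
    0 < a /\ S = [fset d + i * a | i in iota 0 #|` S|].

Lemma ltn_sqrtC (d n : nat) :
  (d%:R < sqrtC (n%:R : algC))%R = (d ^ 2 < n).
Proof.
rewrite -(ltr_pXn2r (_ : 0 < 2)) ?nnegrE ?ler0n ?sqrtC_ge0 ?ler0n //.
by rewrite sqrtCK -natrX ltr_nat.
Qed.

Lemma mem_small_divisors (n d : nat) : 0 < n ->
  (d \in small_divisors n) = [&& d %| n, 1 < d & d ^ 2 < n].
Proof. by move=> n_gt0; rewrite !inE /= ltn_sqrtC dvdn_divisors. Qed.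

Lemma in_arith_progression_small (S : {fset nat}) :
  #|` S| <= 1 -> in_arith_progression S.
Proof.
rewrite leq_eqVlt ltnS leqn0 cardfs_eq0 => /orP[/cardfs1P[x ->]|/eqP->].
  exists x, 1; split=> //; apply/fsetP=> y; rewrite cardfs1 in_fset1.
  apply/eqP/imfsetP => [->|[i]]; first by exists 0; rewrite ?addn0.
  by rewrite /= inE => /eqP-> ->; rewrite addn0.
exists 0, 1; split=> //; apply/fsetP=> y; rewrite cardfs0 in_fset0.
by apply/esym/imfsetP => -[].
Qed.

(* Main.v *)
(** Write A for the set of small divisors of [n]. A divisor of an element of A
    is 1 or lies in A, and a divisor d > 1 of [n] outside A satisfies n <= d^2;
    for |A| <= 2 these two facts already determine the shape of [n].
    If |A| >= 3 and A starts with p, p + a, then p and p + a are prime, and so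
    is p + 2a unless p = 2 and a = 1. If |A| >= 4 and p <> 2, then p(p + a) lies
    in A, at an index divisible by p; so p + pa lies in A, hence so does its
    divisor 1 + a, which forces a = p - 1. This relation also holds for p = 2.
    Let m be the largest element of A. Some px with m < px <= m + 2pa, x in A and
    p, x coprime divides [n] without being in A, so n <= (m + 2pa)^2. Since
    (m - 2a)(m - a)m divides [n] for odd p, and 2[n] for p = 2, this is impossible
    for odd p and bounds m for p = 2, where only n = 60 survives. *)
Require Import Defs.
From mathcomp Require Import all_boot all_order all_algebra all_field.
From mathcomp Require Import finmap.
From mathcomp Require Import zify.

Local Open Scope fset_scope.
Local Open Scope nat_scope.

(** * Divisors of [n] inside and outside its set A of small divisors *)

Lemma prime_mulF (a b : nat) : 1 < a -> 1 < b -> prime (a * b) = false.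
Proof.
move=> a_gt1 b_gt1; apply/negP=> /primeP[_ /(_ a (dvdn_mulr b (dvdnn a)))].
by case/orP=> /eqP; nia.
Qed.

Lemma prime_expF (a n : nat) : 1 < a -> 1 < n -> prime (a ^ n) = false.
Proof.
case: n => [|[|n]] // a_gt1 _; rewrite expnS prime_mulF //.
by rewrite -(exp1n n.+1) ltn_exp2r.
Qed.

Lemma small_divisorsP {n d : nat} : 0 < n ->
  reflect [/\ d %| n, 1 < d & d ^ 2 < n] (d \in small_divisors n).
Proof. by move=> n_gt0; rewrite mem_small_divisors //; apply: and3P. Qed.

Lemma small_divisors_dvd {n d e : nat} : 0 < n ->
  d \in small_divisors n -> e %| d -> 1 < e -> e \in small_divisors n.
Proof.
move=> n_gt0 /(small_divisorsP n_gt0)[dn d_gt1 dlt] ed e_gt1.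
apply/small_divisorsP => //; split=> //; first exact: dvdn_trans dn.
by apply: leq_ltn_trans dlt; rewrite leq_sqr dvdn_leq // ltnW.
Qed.

Lemma leq_sqr_notin_small_divisors {n d : nat} : 0 < n -> 1 < d -> d %| n ->
  d \notin small_divisors n -> n <= d ^ 2.
Proof.
by move=> n_gt0 d_gt1 dn; rewrite mem_small_divisors // dn d_gt1 -leqNgt.
Qed.

Lemma dvdn_leq_sqr_fset1 {n p d : nat} : 0 < n -> small_divisors n = [fset p] ->
  1 < d -> d %| n -> d = p \/ n <= d ^ 2.
Proof.
move=> n_gt0 An d_gt1 dn; have := leq_sqr_notin_small_divisors n_gt0 d_gt1 dn.
by rewrite An in_fset1; case: eqP => [-> _|_ /(_ isT)]; [left | right].
Qed.

Lemma dvdn_leq_sqr_fset2 {n p q d : nat} : 0 < n ->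
  small_divisors n = [fset p; q] ->
  1 < d -> d %| n -> [\/ d = p, d = q | n <= d ^ 2].
Proof.
move=> n_gt0 An d_gt1 dn; have := leq_sqr_notin_small_divisors n_gt0 d_gt1 dn.
rewrite An !inE; case: eqP => [-> _|_]; first by constructor 1.
by case: eqP => [-> _|_ /(_ isT)]; [constructor 2 | constructor 3].
Qed.

(** * Shapes of [n] with at most two small divisors *)

Lemma small_divisors_fset0 {n : nat} : 1 < n -> small_divisors n = fset0 ->
  exists2 p, prime p & n = p \/ n = p ^ 2.
Proof.
move=> n_gt1 An; have n_gt0 := ltnW n_gt1.
have pp := pdiv_prime n_gt1; set p := pdiv n in pp *; exists p => //.
have ple : n <= p ^ 2.
  by rewrite (leq_sqr_notin_small_divisors n_gt0) ?prime_gt1 ?pdiv_dvd ?An.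
have /dvdnP[m nE] : p %| n by apply: pdiv_dvd.
have p_gt1 := prime_gt1 pp.
have [m_le1|m_gt1] := leqP m 1;
  first by left; case: m m_le1 nE => [|[|]] //; lia.
have mp : p <= m by apply: pdiv_min_dvd; rewrite // nE dvdn_mulr.
by right; nia.
Qed.

(** Write [n = p * q * t] with [q] prime. If [t > 1], each of [q] and [t] is either [p] or has
    square at least [n]; the four combinations are settled by comparing sizes. *)
Lemma small_divisors_fset1 {n p : nat} : 1 < n -> small_divisors n = [fset p] ->
  prime p /\ ((exists q, [/\ prime q, p < q & n = p * q])
              \/ n = p ^ 3 \/ n = p ^ 4).
Proof.
move=> n_gt1 An; have n_gt0 := ltnW n_gt1.
have pA : p \in small_divisors n by rewrite An in_fset1.
have [/dvdnP[m nE] p_gt1 p_lt] := small_divisorsP n_gt0 pA.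
have pmin d : 1 < d -> d %| n -> p <= d.
  by move=> d1 /(dvdn_leq_sqr_fset1 n_gt0 An d1)[->//|]; nia.
have pp : prime p.
  have := small_divisors_dvd n_gt0 pA (pdiv_dvd p)
    (prime_gt1 (pdiv_prime p_gt1)).
  by rewrite An in_fset1 => /eqP <-; apply: pdiv_prime.
split=> //; have m_gt1 : 1 < m by nia.
have [q qp /dvdnP[t mE]] : exists2 q, prime q & q %| m.
  by exists (pdiv m); rewrite ?pdiv_dvd ?pdiv_prime.
have q_gt1 := prime_gt1 qp.
have qn : q %| n by rewrite nE mE mulnAC dvdn_mull.
have pq : p <= q by apply: pmin.
have [t_le1|t_gt1] := leqP t 1.
  have t1 : t = 1 by case: t t_le1 mE => [|[|]] //; lia.
  by left; exists q; split=> //; rewrite nE mE t1 ?mul1n in p_lt *; [nia | lia].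
have tn : t %| n by rewrite nE mE -mulnA dvdn_mulr.
(* If [q] or [t] is [p], then [p ^ 2] divides [n] and differs from [p], so it lies outside A. *)
have n_le : n <= (p ^ 2) ^ 2 \/ q <> p /\ t <> p.
  have p2_gt1 : 1 < p ^ 2 by nia.
  case: (q =P p) => [qE|qNp]; last case: (t =P p) => [tE|tNp]; last by right.
  - left; have p2n : p ^ 2 %| n by apply/dvdnP; exists t; rewrite nE mE qE; lia.
    by case: (dvdn_leq_sqr_fset1 n_gt0 An p2_gt1 p2n) => //; nia.
  left; have p2n : p ^ 2 %| n by apply/dvdnP; exists q; rewrite nE mE tE; lia.
  by case: (dvdn_leq_sqr_fset1 n_gt0 An p2_gt1 p2n) => //; nia.
case: (dvdn_leq_sqr_fset1 n_gt0 An q_gt1 qn) => [qE|q_le];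
  case: (dvdn_leq_sqr_fset1 n_gt0 An t_gt1 tn) => [tE|t_le].
- by right; left; rewrite nE mE qE tE; lia.
- right; right; case: n_le => [n_le|[]//].
  (* Here [n = p ^ 2 * t]: [n <= t ^ 2] gives [p ^ 2 <= t], and [n <= p ^ 4] gives the opposite
     bound. *)
  have tE : t = p ^ 2 by nia.
  by rewrite nE mE qE tE; lia.
- case: n_le => [n_le|[_ []]//].
  have qE : q = p ^ 2 by nia.
  by move: qp; rewrite qE prime_expF.
(* Two squares at least [n] would give [n <= q * t], against [n = p * q * t]. *)
by exfalso; nia.
Qed.

(** The least prime factor of [x] is [p] or [x]. If it is [p], the cofactor of [p] in [x] is an
    element of A below [x], hence [p]. So [x] is [p ^ 2] or prime, and in both cases a prime factor
    [s] of the remaining cofactor of [n] is in A or satisfies [n <= s ^ 2]. *)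
Lemma small_divisors_fset2 {n p x : nat} : 1 < n -> p < x ->
  small_divisors n = [fset p; x] ->
  prime p /\ [\/ x = p ^ 2 /\ (n = p ^ 5 \/ n = p ^ 6),
    x = p ^ 2 /\ exists q, [/\ prime q, p ^ 2 < q & n = p ^ 2 * q],
    prime x /\ n = p * x ^ 2 |
    [/\ prime x, x < p ^ 2 & n = p ^ 2 * x]].
Proof.
move=> n_gt1 p_lt_x An; have n_gt0 := ltnW n_gt1.
have pA : p \in small_divisors n by rewrite An !inE eqxx.
have xA : x \in small_divisors n by rewrite An !inE eqxx orbT.
have [pn p_gt1 p_lt] := small_divisorsP n_gt0 pA.
have [xn x_gt1 x_lt] := small_divisorsP n_gt0 xA.
have p_lt_p2 : p < p ^ 2 by rewrite -[ltnLHS]expn1 ltn_exp2l.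
have p2_gt1 : 1 < p ^ 2 := ltn_trans p_gt1 p_lt_p2.
have pmin d : 1 < d -> d %| n -> p <= d.
  by move=> d1 /(dvdn_leq_sqr_fset2 n_gt0 An d1)[->|->|] //; nia.
have pp : prime p.
  have := small_divisors_dvd n_gt0 pA (pdiv_dvd p)
    (prime_gt1 (pdiv_prime p_gt1)).
  rewrite An !inE => /orP[] /eqP E; first by rewrite -E pdiv_prime.
  by have := pdiv_leq (ltnW p_gt1); lia.
split=> //.
have xE : x = p ^ 2 \/ prime x.
  have := small_divisors_dvd n_gt0 xA (pdiv_dvd x)
    (prime_gt1 (pdiv_prime x_gt1)).
  rewrite An !inE => /orP[] /eqP E; last by right; rewrite -E pdiv_prime.
  left; have /dvdnP[y yE] : p %| x by rewrite -E pdiv_dvd.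
  have y_gt1 : 1 < y by nia.
  have yx : y %| x by rewrite yE dvdn_mulr.
  have := small_divisors_dvd n_gt0 xA yx y_gt1.
  by rewrite An !inE => /orP[] /eqP yE'; nia.
case: xE => [xE|xp].
- subst x; have /dvdnP[m nE] := xn; have m_gt : p ^ 2 < m by nia.
  have [s sp /dvdnP[t mE]] : exists2 s, prime s & s %| m.
    by exists (pdiv m); rewrite ?pdiv_dvd ?pdiv_prime //; lia.
  have s_gt1 := prime_gt1 sp.
  have sn : s %| n by rewrite nE mE mulnAC dvdn_mull.
  have tn : t %| n by rewrite nE mE -mulnA dvdn_mulr.
  have p3_le : p ^ 3 %| n -> n <= (p ^ 3) ^ 2.
    have p3_gt1 : 1 < p ^ 3 by rewrite -(exp1n 3) ltn_exp2r.
    have lt23 : p ^ 2 < p ^ 3 by rewrite ltn_exp2l.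
    by move=> /(dvdn_leq_sqr_fset2 n_gt0 An p3_gt1)[||//]; lia.
  have t_gt0 : 0 < t by case: t mE {tn} => //; lia.
  have [sE|sNp] := eqVneq s p.
    constructor 1; split=> //; subst s.
    have {}p3_le : n <= (p ^ 3) ^ 2.
      by apply: p3_le; apply/dvdnP; exists t; rewrite nE mE; lia.
    have {}nE : n = t * p ^ 3 by rewrite nE mE; lia.
    have t_le : t <= p ^ 3 by nia.
    have t_gt1 : 1 < t by nia.
    (* [t = p] would give [n = p ^ 4], against [x ^ 2 < n]; the other two cases give [p ^ 5] and
       [p ^ 6]. *)
    case: (dvdn_leq_sqr_fset2 n_gt0 An t_gt1 tn) => [tE|tE|t_ge].
    + by subst t; nia.
    + by left; rewrite nE tE; lia.
    right; have tE : t = p ^ 3 by nia.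
    by rewrite nE tE; lia.
  case: (dvdn_leq_sqr_fset2 n_gt0 An s_gt1 sn) => [sE|sE|s_ge].
  + by rewrite sE eqxx in sNp.
  + by move: sp; rewrite sE prime_expF.
  have s_ge' : p ^ 2 * t <= s.
    by rewrite -(leq_pmul2r (ltnW s_gt1)); rewrite nE mE in s_ge; lia.
  have [t_le1|t_gt1] := leqP t 1.
    constructor 2; split=> //; exists s; have t1 : t = 1 by lia.
    by rewrite nE mE t1 in m_gt *; split=> //; lia.
  (* If [t] is not in A, then [n <= t ^ 2] means [s * p ^ 2 <= t], incompatible with
     [p ^ 2 * t <= s]. *)
  have p_dvd_t : p %| t.
    case: (dvdn_leq_sqr_fset2 n_gt0 An t_gt1 tn) => [->|->|t_ge] //.
      by rewrite dvdn_exp.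
    have st : s * p ^ 2 <= t.
      by rewrite -(leq_pmul2r t_gt0); rewrite nE mE in t_ge; lia.
    have s_lt : s < s * p ^ 2 by rewrite ltn_Pmulr ?ltn_sqr //; nia.
    have t_le : t <= p ^ 2 * t by rewrite leq_pmull //; nia.
    have := leq_trans s_lt (leq_trans st (leq_trans t_le s_ge')).
    by rewrite ltnn.
  have /dvdnP[u tE] := p_dvd_t.
  have {}p3_le : n <= (p ^ 3) ^ 2.
    by apply: p3_le; apply/dvdnP; exists (s * u); rewrite nE mE tE; lia.
  (* Both bounds use [p <= t]: [s * p ^ 3 <= n <= p ^ 6] from above and [p ^ 3 <= p ^ 2 * t <= s]
     from below. *)
  have sE : s = p ^ 3.
    have p_le_t : p <= t by apply: dvdn_leq.
    have p3_gt0 : 0 < p ^ 3 by rewrite expn_gt0; lia.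
    apply/eqP; rewrite eqn_leq; apply/andP; split.
      rewrite -(leq_pmul2r p3_gt0) mulnn; apply: leq_trans p3_le.
      rewrite nE mE (_ : t * s * p ^ 2 = s * (t * p ^ 2)); last by lia.
      by rewrite leq_mul // expnS leq_mul.
    by apply: leq_trans s_ge'; rewrite expnSr leq_mul.
  by move: sp; rewrite sE prime_expF.
have [pNx p2Nx] : p <> x /\ p ^ 2 <> x.
  split=> [|p2E]; first lia.
  by move: xp; rewrite -p2E prime_expF.
have /dvdnP[m nE] : p * x %| n.
  by rewrite Gauss_dvd ?pn // prime_coprime // dvdn_prime2 //; apply/eqP.
(* [p * x] exceeds both elements of A, so its square is at least [n = m * (p * x)]. *)
have m_le : m <= p * x.
  have px_gt : x < p * x by rewrite ltn_Pmull // ltnW.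
  have px_gt1 : 1 < p * x := ltn_trans x_gt1 px_gt.
  have pxn : p * x %| n by rewrite nE dvdn_mull.
  case: (dvdn_leq_sqr_fset2 n_gt0 An px_gt1 pxn) => [pxE|pxE|].
  - by move: px_gt; rewrite pxE ltnNge ltnW.
  - by move: px_gt; rewrite pxE ltnn.
  by rewrite {1}nE -mulnn leq_pmul2r // ltnW.
have m_gt1 : 1 < m.
  rewrite ltnNge; apply/negP=> m_le1; move: x_lt.
  rewrite {1}nE ltnNge -mulnn mulnA leq_mul2r => /negP[]; apply/orP; right.
  by apply: leq_trans (leq_mul m_le1 (leqnn p)) _; rewrite mul1n ltnW.
have [s sp /dvdnP[t mE]] : exists2 s, prime s & s %| m.
  by exists (pdiv m); rewrite ?pdiv_dvd ?pdiv_prime //; lia.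
have s_gt1 := prime_gt1 sp.
have sn : s %| n by rewrite nE mE mulnAC dvdn_mull.
have tn : t %| n by rewrite nE mE -mulnA dvdn_mulr.
have t_gt0 : 0 < t by case: t mE {tn} => //; lia.
have p4_le : p ^ 2 %| n -> n <= (p ^ 2) ^ 2.
  by move=> /(dvdn_leq_sqr_fset2 n_gt0 An p2_gt1)[p2E||//]; [lia|].
have t_ge : 1 < t -> p <= t by move=> /pmin; apply.
case: (dvdn_leq_sqr_fset2 n_gt0 An s_gt1 sn) => [sE|sE|s_ge].
- subst s; have {}nE : n = t * x * p ^ 2 by rewrite nE mE; lia.
  have p4_lt : t * x <= p ^ 2.
    by rewrite -(leq_pmul2r (ltnW p2_gt1)) -nE mulnn p4_le // nE dvdn_mull.
  (* Otherwise [p <= t], and [p < x] gives [p ^ 2 < t * x]. *)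
  have t1 : t = 1.
    apply/eqP; rewrite eqn_leq t_gt0 andbT leqNgt; apply/negP=> /t_ge p_le_t.
    move: p4_lt; rewrite leqNgt => /negP[]; apply: (@leq_ltn_trans (t * p)).
      by rewrite leq_mul2r p_le_t orbT.
    by rewrite ltn_pmul2l.
  constructor 4; rewrite {}nE t1 mul1n in x_lt *; split=> //; last exact: mulnC.
  by rewrite -(ltn_pmul2l (ltnW x_gt1)) mulnn.
- subst s; have {}nE : n = t * p * x ^ 2 by rewrite nE mE; lia.
  have t_le : t <= p by move: m_le; rewrite mE leq_pmul2r // ltnW.
  have [t_le1|/t_ge {}t_ge] := leqP t 1.
    have t1 : t = 1 by lia.
    by constructor 3; rewrite nE t1 mul1n.
  have tE : t = p by lia.
  have {}nE : n = p ^ 2 * x ^ 2 by rewrite nE tE -mulnn.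
  have : p ^ 2 %| n by rewrite nE dvdn_mulr.
  by move/p4_le; rewrite nE -[leqRHS]mulnn leq_pmul2l ?leq_sqr; lia.
have {}nE : n = t * (p * x) * s by rewrite nE mE; lia.
have s_ge' : t * (p * x) <= s.
  by rewrite -(leq_pmul2r (ltnW s_gt1)) -nE mulnn.
have px_gt0 : 0 < p * x by rewrite muln_gt0; lia.
(* [s <= m <= p * x] meets [t * (p * x) <= s], and a product of two primes is not prime. *)
have sE : s = p * x.
  apply/eqP; rewrite eqn_leq (leq_trans _ s_ge') ?leq_pmull // andbT.
  by apply: leq_trans m_le; rewrite mE leq_pmull.
by move: sp; rewrite sE prime_mulF.
Qed.

(** * Primality of the first terms of the progression *)

Lemma prime_coprime_lt (p q : nat) :
  prime p -> prime q -> p < q -> coprime p q.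
Proof. by move=> pp qp pq; rewrite prime_coprime // dvdn_prime2 // ltn_eqF. Qed.

(** Membership form of the hypothesis, so that elements of A are handled through their index. *)
Definition small_divisors_ap (n p a k : nat) : Prop :=
  [/\ 0 < n, 0 < a & forall d,
    d \in small_divisors n <-> exists2 i, i < k & d = p + i * a].

Lemma small_divisors_apI {n p a k : nat} : 0 < n -> 0 < a ->
  small_divisors n = [fset p + i * a | i in iota 0 k] ->
  small_divisors_ap n p a k.
Proof.
move=> n_gt0 a_gt0 An; split=> // d; rewrite An.
split=> [/imfsetP[i /=]|[i ik ->]].
  by rewrite mem_iota => ik ->; exists i.
by apply/imfsetP; exists i; rewrite //= mem_iota.
Qed.

Section Shape.
Context {n p a k : nat} (H : small_divisors_ap n p a k).

Lemma ap_gt0 : 0 < n. Proof. by case: H. Qed.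

Lemma ap_mem (i : nat) : i < k -> p + i * a \in small_divisors n.
Proof. by case: H => _ _ AE ik; apply/AE; exists i. Qed.

Lemma ap_dvd (i : nat) : i < k -> p + i * a %| n.
Proof. by move/ap_mem/(small_divisorsP ap_gt0) => []. Qed.

Lemma ap_leq (e : nat) : e \in small_divisors n -> p <= e <= p + k.-1 * a.
Proof.
case: H => _ a_gt0 AE /AE[i ik ->].
by rewrite leq_addr leq_add2l leq_pmul2r //; lia.
Qed.

(** A has a gap between [p] and [p + a]; divisors of terms such as [a.+1] are identified with [p]
    through it. *)
Lemma ap_first (e : nat) : e \in small_divisors n -> e < p + a -> e = p.
Proof. by case: H => _ a_gt0 AE /AE[[|i] _ ->]; nia. Qed.

Lemma ap_min (d : nat) : 0 < k -> d %| n -> 1 < d -> p <= d.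
Proof.
move=> k_gt0 dn d_gt1.
have [/ap_leq/andP[]//|dA] := boolP (d \in small_divisors n).
have [_ _] := small_divisorsP ap_gt0 (ap_mem _ k_gt0).
have := leq_sqr_notin_small_divisors ap_gt0 d_gt1 dn dA.
by rewrite mul0n addn0 => nd pn; rewrite -leq_sqr ltnW // (leq_trans pn).
Qed.

(** The least prime factor of a term is in A, hence itself a term, and its size bounds its index.
    For [i <= 3] this leaves few ways for a term not to be prime. *)
Lemma ap_pdiv (i : nat) : i < k ->
  exists j, [/\ j <= i, prime (p + j * a) & p + j * a %| p + i * a].
Proof.
case: (H) => n_gt0 a_gt0 AE ik; have iA := ap_mem _ ik.
have [_ i_gt1 _] := small_divisorsP n_gt0 iA.
have pA := small_divisors_dvd n_gt0 iA (pdiv_dvd _)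
  (prime_gt1 (pdiv_prime i_gt1)).
have /AE[j jk jE] := pA.
exists j; rewrite -jE pdiv_prime // pdiv_dvd; split=> //.
have := pdiv_leq (ltnW i_gt1).
by rewrite jE leq_add2l leq_pmul2r.
Qed.

Lemma ap_prime0 : 0 < k -> prime p.
Proof.
move=> /ap_pdiv[j [j0 jp _]]; move: jp.
by rewrite (_ : j = 0) ?mul0n ?addn0 //; lia.
Qed.

(** Otherwise [p] divides [a], say [a = b * p]. Then [b.+1] divides [p + a] and [(2 * b).+1] divides
    [p + 2 * a], so both are in A. The second is below [p + a], hence equal to [p], yet
    [p <= b.+1]. *)
Lemma ap_prime1 : 2 < k -> prime (p + a).
Proof.
move=> k_gt2; have k_gt1 : 1 < k by lia.
have pp := ap_prime0 (ltnW k_gt1); have p_gt1 := prime_gt1 pp.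
case: (H) => n_gt0 a_gt0 AE.
have [j [j_le jp jd]] := ap_pdiv _ k_gt1; move: j_le jp jd; rewrite mul1n.
case: j => [|[|//]] _; last by rewrite mul1n.
rewrite mul0n addn0 dvdn_addr // => _ /dvdnP[b aE].
have b1A : b.+1 \in small_divisors n.
  apply: (small_divisors_dvd n_gt0 (ap_mem _ k_gt1)); last by nia.
  by rewrite mul1n aE -mulSn dvdn_mulr.
have b2A : (2 * b).+1 \in small_divisors n.
  apply: (small_divisors_dvd n_gt0 (ap_mem _ k_gt2)); last by nia.
  by rewrite aE mulnA -mulSn dvdn_mulr.
have /andP[p_le _] := ap_leq _ b1A.
have := ap_first _ b2A; nia.
Qed.

(** A smaller prime term dividing [p + 2 * a] can only be [p], and then [p] divides 2, since [p]
    dividing [a] would contradict the primality of [p + a]. With [p = 2], [a.+1] divides the third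
    term and so equals 2. *)
Lemma ap_prime2 : 2 < k -> prime (p + 2 * a) \/ p = 2 /\ a = 1.
Proof.
move=> k_gt2; have k_gt0 : 0 < k by lia.
have pp := ap_prime0 k_gt0; have p_gt1 := prime_gt1 pp.
have qp := ap_prime1 k_gt2; case: (H) => n_gt0 a_gt0 AE.
have [j [j_le jp jd]] := ap_pdiv _ k_gt2; move: j_le jp jd.
case: j => [|[|[|//]]] _; last by left.
- rewrite mul0n addn0 dvdn_addr // => _; rewrite Euclid_dvdM // => /orP[|pa].
    rewrite dvdn_prime2 // => /eqP pE; right; split=> //.
    have : a.+1 \in small_divisors n.
      apply: (small_divisors_dvd n_gt0 (ap_mem _ k_gt2)); last by lia.
      by apply/dvdnP; exists 2; lia.
    by move/ap_first; lia.
  have : p %| p + a by rewrite dvdn_addr.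
  by rewrite dvdn_prime2 // => /eqP; lia.
rewrite mul1n (_ : p + 2 * a = p + a + a); last by lia.
by rewrite dvdn_addr // => _ /(dvdn_leq a_gt0); lia.
Qed.

Lemma ap_coprime0 : 2 < k -> coprime p a.
Proof.
move=> k_gt2; have k_gt0 : 0 < k by lia.
have pp := ap_prime0 k_gt0; have qp := ap_prime1 k_gt2.
rewrite prime_coprime //; apply/negP=> pa.
have : p %| p + a by rewrite dvdn_addr.
by case: (H) => _ a_gt0 _; rewrite dvdn_prime2 // => /eqP; lia.
Qed.

(** * Progressions with at least four terms *)

Lemma ap_prime3 : 3 < k -> p != 2 -> prime (p + 3 * a) \/ p = 3 /\ a = 2.
Proof.
move=> k_gt3 pN2; have k_gt2 : 2 < k by lia.
have k_gt0 : 0 < k by lia.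
have pp := ap_prime0 k_gt0; have p_gt1 := prime_gt1 pp.
have qp := ap_prime1 k_gt2; case: (H) => n_gt0 a_gt0 AE.
have [j [j_le jp jd]] := ap_pdiv _ k_gt3; move: j_le jp jd.
case: j => [|[|[|[|//]]]] _; last by left.
(* [p] divides [3 * a] and is coprime to [a], so [p = 3]; then [a.+1] divides [3 + 3 * a] and equals
   [p]. *)
- rewrite mul0n addn0 dvdn_addr // => _; rewrite Gauss_dvdl ?ap_coprime0 //.
  rewrite dvdn_prime2 // => /eqP pE; right; split=> //.
  have : a.+1 \in small_divisors n.
    apply: (small_divisors_dvd n_gt0 (ap_mem _ k_gt3)); last by lia.
    by apply/dvdnP; exists 3; lia.
  by move/ap_first; lia.
- rewrite mul1n (_ : p + 3 * a = p + a + 2 * a); last by lia.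
  rewrite dvdn_addr // => _; rewrite Euclid_dvdM // => /orP[] /dvdn_leq; lia.
rewrite (_ : p + 3 * a = p + 2 * a + a); last by lia.
by rewrite dvdn_addr // => _ /(dvdn_leq a_gt0); lia.
Qed.

(** When the first four terms are primes, their product divides [n] and exceeds the square of the
    product of the first two. *)
Lemma ap_mul01 : 3 < k -> p != 2 -> p * (p + a) \in small_divisors n.
Proof.
move=> k_gt3 pN2; have k_gt2 : 2 < k by lia.
have k_gt0 : 0 < k by lia.
have pp := ap_prime0 k_gt0; have p_gt1 := prime_gt1 pp.
have qp := ap_prime1 k_gt2; case: (H) => n_gt0 a_gt0 AE.
have rp : prime (p + 2 * a).
  by case: (ap_prime2 k_gt2) => // -[p2]; rewrite p2 in pN2.
have pn := ap_dvd 0 k_gt0; have qn : p + 1 * a %| n by apply: ap_dvd; lia.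
have rn := ap_dvd 2 k_gt2; have sn := ap_dvd 3 k_gt3.
rewrite mul0n mul1n addn0 in pn qn.
have pqn : p * (p + a) %| n.
  by rewrite Gauss_dvd ?pn // prime_coprime_lt //; lia.
apply/small_divisorsP => //; split=> //.
  by rewrite (leq_trans p_gt1) // leq_pmulr // addn_gt0 a_gt0 orbT.
case: (ap_prime3 k_gt3 pN2) => [sp|[pE aE]].
  set q := p + a in qp qn pqn *; set r := p + 2 * a in rp rn.
  set s := p + 3 * a in sp sn.
  have [pq qr rs] : [/\ p < q, q < r & r < s] by clear -a_gt0; split; lia.
  have [pr qs] := (ltn_trans pq qr, ltn_trans qr rs).
  have ps := ltn_trans pr rs.
  have rsn : r * s %| n by rewrite Gauss_dvd ?rn // prime_coprime_lt.
  have pqrsn : (p * q) * (r * s) %| n.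
    rewrite Gauss_dvd ?pqn //.
    by rewrite coprimeMl !coprimeMr !prime_coprime_lt.
  apply: leq_trans (dvdn_leq n_gt0 pqrsn).
  by rewrite -mulnn ltn_pmul2l ?muln_gt0 ?prime_gt0 // ltn_mul.
rewrite pE aE in sn rn qn *.
(* The terms are 3, 5, 7, 9, and 315 exceeds the square 225 of [3 * 5]. *)
have : 9 * (5 * 7) %| n by rewrite !Gauss_dvd // sn qn.
by move/(dvdn_leq n_gt0); lia.
Qed.

(** For odd [p], write [p * (p + a) = p + j * a]. Then [p] divides [j], so [p < k] and [p + p * a]
    is a term; its divisor [a.+1] is in A and below [p + a]. *)
Lemma ap_step : 3 < k -> a.+1 = p.
Proof.
move=> k_gt3; have k_gt2 : 2 < k by lia.
have k_gt0 : 0 < k by lia.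
have pp := ap_prime0 k_gt0; have p_gt1 := prime_gt1 pp.
have [p2|pN2] := eqVneq p 2.
  case: (ap_prime2 k_gt2) => [|[-> ->] //].
  by rewrite p2 -{1}[2]muln1 -mulnDr prime_mulF //; case: H.
case: (H) => n_gt0 a_gt0 AE.
have /AE[j jk jE] := ap_mul01 k_gt3 pN2.
have : p %| p + j * a by rewrite -jE dvdn_mulr.
rewrite dvdn_addr // Gauss_dvdl ?ap_coprime0 // => p_dvd_j.
have j_gt0 : 0 < j by case: j jE {jk p_dvd_j} => //; nia.
have p_lt_k : p < k by apply: leq_ltn_trans jk; apply: dvdn_leq.
have : a.+1 \in small_divisors n.
  apply: (small_divisors_dvd n_gt0 (ap_mem _ p_lt_k)); last by lia.
  by rewrite -mulnS dvdn_mull.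
by move/ap_first; lia.
Qed.

(** Since [a < p], two consecutive terms are not both divisible by [p]. With [b] the quotient of
    [k.-1] by [p], the index [b] or [b.+1] thus gives a term [x] coprime to [p], and [p * x] is just
    beyond the last term. *)
Lemma ap_upper : 3 < k -> n <= (p + k.-1 * a + 2 * p * a) ^ 2.
Proof.
move=> k_gt3; have k_gt0 : 0 < k by lia.
have pp := ap_prime0 k_gt0; have p_gt1 := prime_gt1 pp.
have aE := ap_step k_gt3; case: (H) => n_gt0 a_gt0 AE.
have pn := ap_dvd 0 k_gt0; rewrite mul0n addn0 in pn.
set b := k.-1 %/ p.
have b_le : b * p <= k.-1 by apply: leq_trunc_div.
have b_gt : k.-1 < b.+1 * p by rewrite ltn_ceil // ltnW.
have [i /andP[bi ib] ip] : exists2 i, b <= i <= b.+1 & coprime p (p + i * a).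
  have [|b0] := boolP (coprime p (p + b * a)).
    by exists b; rewrite ?leqnn ?leqnSn.
  exists b.+1; rewrite ?leqnn ?leqnSn // prime_coprime //.
  rewrite prime_coprime // negbK in b0.
  by rewrite mulSn addnCA dvdn_addl // gtnNdvd //; lia.
have i_lt : i < k by nia.
have pxn : p * (p + i * a) %| n by rewrite Gauss_dvd ?pn ?ap_dvd.
have p_gt0 := ltnW p_gt1.
(* As [p = a.+1], [p * x] continues the progression at index [p * i.+1], which lies above [k.-1] and
   is at most [k.-1 + 2 * p]. *)
have pxE : p * (p + i * a) = p + p * i.+1 * a by rewrite -{2}aE; lia.
have px_gt : p + k.-1 * a < p * (p + i * a).
  rewrite pxE ltn_add2l ltn_pmul2r //; apply: leq_trans b_gt _.
  by rewrite mulnC leq_pmul2l.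
apply: (@leq_trans ((p * (p + i * a)) ^ 2)).
  apply: leq_sqr_notin_small_divisors => //.
    by rewrite (leq_trans p_gt1) // leq_pmulr // addn_gt0 p_gt0.
  by apply/negP => /ap_leq/andP[_]; rewrite leqNgt px_gt.
rewrite leq_sqr pxE -addnA -mulnDl leq_add2l leq_pmul2r //.
apply: (@leq_trans (p * b.+2)); first by rewrite leq_pmul2l.
by rewrite -addn2 mulnDr [p * b]mulnC [p * 2]mulnC leq_add2r.
Qed.

(** For odd [p], [a] is even, so the last three terms [y], [y + a], [y + 2 * a] are odd and pairwise
    coprime. Their product divides [n] and is too large for [ap_upper]. *)
Lemma ap_step_eq1 : 3 < k -> p = 2 /\ a = 1.
Proof.
move=> k_gt3; have k_gt2 : 2 < k by lia.
have k_gt0 : 0 < k by lia.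
have pp := ap_prime0 k_gt0; have aE := ap_step k_gt3.
have n_le := ap_upper k_gt3; case: (H) => n_gt0 a_gt0 AE.
have [p2|pN2] := eqVneq p 2; first by lia.
exfalso; have p_odd : odd p by case: (even_prime pp) pN2 => // ->.
have a_even : odd a = false by move: p_odd; rewrite -aE /=; case: odd.
have [j kE] : exists j, k = j.+3 by exists (k - 3); lia.
have [j0 j1 j2] : [/\ j < k, j.+1 < k & j.+2 < k].
  by rewrite kE; split; lia.
set y := p + j * a.
have yE : y + a = p + j.+1 * a by rewrite /y -addnA -mulSnr.
have y2E : y + 2 * a = p + j.+2 * a by rewrite /y -addnA -mulnDl addn2.
have yn : y %| n := ap_dvd _ j0.
have yan : y + a %| n by rewrite yE ap_dvd.
have y2an : y + 2 * a %| n by rewrite y2E ap_dvd.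
have y_a : coprime y a.
  rewrite coprime_sym /coprime /y addnC gcdnMDl gcdnC.
  exact: ap_coprime0 k_gt2.
have y_odd : odd y by rewrite /y oddD oddM a_even andbF p_odd.
have cop1 : coprime y (y + a) by rewrite /coprime gcdnDl.
have cop2 : coprime (y + a) (y + 2 * a).
  rewrite (_ : y + 2 * a = y + a + a); last by lia.
  by rewrite /coprime gcdnDl gcdnC gcdnDr gcdnC.
have cop3 : coprime y (y + 2 * a).
  by rewrite /coprime gcdnDl -/(coprime _ _) coprimeMr y_a andbT coprimen2.
have prod_n : y * (y + a) * (y + 2 * a) %| n.
  by rewrite !Gauss_dvd ?yn ?yan // coprimeMl cop3.
have /ap_leq/andP[_ pq_le] := ap_mul01 k_gt3 pN2.
have m_eq : p + k.-1 * a = y + 2 * a by rewrite kE y2E.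
have {prod_n} := leq_trans (dvdn_leq n_gt0 prod_n) n_le.
rewrite m_eq in pq_le *.
have a_gt1 : 1 < a by case: a a_gt0 a_even => [|[|]].
move: pq_le; rewrite -aE; clearbody y; clear -a_gt1 => pq_le.
rewrite leqNgt => /negP[].
(* This is [p * (p + a) <= y + 2 * a] with [p = a.+1]. *)
have y_ge : 2 * a * a + a + 1 <= y by lia.
have y_ge6 : 6 <= y by nia.
have: y + 2 * a + 2 * a.+1 * a <= 2 * y + 3 * a by lia.
rewrite -leq_sqr => le1; apply: leq_ltn_trans le1 _.
(* [(2 * y + 3 * a) ^ 2] is at most [5 * (y + a) * (y + 2 * a)], and [5 < y]. *)
apply: (@leq_ltn_trans (5 * ((y + a) * (y + 2 * a)))); first by nia.
by rewrite -mulnA ltn_pmul2r //; nia.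
Qed.

(** Here A consists of all integers from 2 to [k.+1], so 3, 4 and 5 divide [n], hence 60 does. *)
Lemma ap_long : 3 < k -> [/\ k = 5, p = 2, a = 1 & n = 60].
Proof.
move=> k_gt3; have [pE aE] := ap_step_eq1 k_gt3.
have n_le := ap_upper k_gt3; case: (H) => n_gt0 a_gt0 AE.
have kn d : 2 <= d <= k.+1 -> d %| n.
  by move=> dk; have := ap_dvd (d - 2); rewrite pE aE muln1 subnKC; lia.
have nk d : d %| n -> k.+1 < d -> n <= d ^ 2.
  move=> dn d_gt; apply: leq_sqr_notin_small_divisors => //; first by lia.
  by apply/negP => /ap_leq; rewrite pE aE; lia.
have n60 : 60 %| n.
  by rewrite (@Gauss_dvd 4 15) // (@Gauss_dvd 3 5) // !kn; lia.
have n_ge := dvdn_leq n_gt0 n60.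
have k_lt7 : k < 7.
  rewrite ltnNge; apply/negP=> k_ge7.
  have [j kE] : exists j, k = j.+1 by exists k.-1; lia.
  have [/kn d1 /kn d2 /kn d3] :
    [/\ 2 <= j <= k.+1, 2 <= j.+1 <= k.+1 & 2 <= j.+2 <= k.+1] by split; lia.
  (* The gcd of [j] and [j.+2] is at most 2, so [j * j.+1 * j.+2 <= 2 * n]; for [j >= 6] this
     exceeds [2 * (j + 6) ^ 2]. *)
  have lcm_n : lcmn j j.+2 * j.+1 %| n.
    rewrite Gauss_dvd ?d2 ?dvdn_lcm ?d1 ?d3 //.
    apply: (@coprime_dvdl _ (j * j.+2)).
      by rewrite dvdn_lcm dvdn_mulr ?dvdn_mull.
    by rewrite coprimeMl coprimenS coprimeSn.
  have gcd_le : gcdn j j.+2 <= 2.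
    by rewrite -addn2 gcdnDl dvdn_leq // dvdn_gcdr.
  have prod_le : j * j.+2 * j.+1 <= 2 * n.
    by rewrite -(muln_lcm_gcd j j.+2) mulnAC mulnC leq_mul // dvdn_leq.
  move: prod_le n_le k_ge7; rewrite kE pE aE /= !muln1 ltnS; clear.
  move=> prod_le n_le j_ge6; have {n_le} n_le : n <= (j + 6) ^ 2.
    by rewrite (_ : j + 6 = 2 + j + 2 * 2) //; lia.
  by nia.
(* 10 divides 60 and is larger than [k.+1 <= 7]. *)
have n_le100 : n <= 100.
  apply: (nk 10); last by lia.
  by apply: dvdn_trans n60.
have nE : n = 60 by case/dvdnP: n60 n_le100 n_ge => j ->; lia.
(* For [k = 4], 6 would be outside A and force [60 <= 36]; for [k = 6], 7 would divide 60. *)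
split=> //; case: (ltngtP k 5) => // k5.
  by have := nk 6; rewrite nE; lia.
have := kn 7; rewrite nE; have -> : k = 6 by lia.
by move=> /(_ isT).
Qed.

(** * Progressions with exactly three terms *)

Lemma ap_three : k = 3 ->
  (p = 2 /\ a = 1 /\ (n = 24 \/ n = 36)) \/
  [/\ prime p, prime (p + a), prime (p + 2 * a) &
      n = p * (p + a) * (p + 2 * a)].
Proof.
move=> k3; have k_gt2 : 2 < k by rewrite k3.
have k_gt0 : 0 < k by rewrite k3.
have pp := ap_prime0 k_gt0; have qp := ap_prime1 k_gt2.
case: (H) => n_gt0 a_gt0 AE.
have pn := ap_dvd 0 k_gt0; have qn : p + 1 * a %| n by apply: ap_dvd; lia.
have rn := ap_dvd 2 k_gt2; rewrite mul0n mul1n addn0 in pn qn.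
case: (ap_prime2 k_gt2) => [rp|[pE aE]]; [right | left].
  have [pq qr] : p < p + a /\ p + a < p + 2 * a by clear -a_gt0; lia.
  have pqn : p * (p + a) %| n by rewrite Gauss_dvd ?pn // prime_coprime_lt.
  have /dvdnP[t tE] : p * (p + a) * (p + 2 * a) %| n.
    rewrite Gauss_dvd ?pqn // coprimeMl !prime_coprime_lt //.
    exact: ltn_trans qr.
  split=> //; have [t_le1|t_gt1] := leqP t 1.
    have t1 : t = 1 by case: t t_le1 tE n_gt0 => [|[]] // _ ->.
    by rewrite tE t1 mul1n.
  have p_le : p <= t by apply: ap_min t_gt1 => //; rewrite tE dvdn_mulr.
  have pq_gt1 : 1 < p * (p + a).
    by rewrite (leq_trans (prime_gt1 pp)) // leq_pmulr // prime_gt0.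
  (* From [p <= t] and [p + a < p + 2 * a], the square of [p * (p + a)] is below [n]. But every
     element of A is prime here. *)
  have /AE[i ik iE] : p * (p + a) \in small_divisors n.
    apply/small_divisorsP => //; split=> //.
    rewrite tE mulnCA -mulnn ltn_pmul2l; last exact: ltnW.
    apply: (@leq_ltn_trans (t * (p + a))).
      by rewrite leq_pmul2r ?prime_gt0.
    by rewrite ltn_pmul2l // ltnW.
  have : prime (p + i * a).
    rewrite k3 in ik; case: i ik {iE} => [|[|[|]]] // _.
      by rewrite mul0n addn0.
    by rewrite mul1n.
  by rewrite -iE prime_mulF ?prime_gt1.
split=> //; split=> //; rewrite pE aE in pn qn rn.
(* A is 2, 3, 4: [n] is a multiple of 12, above 16 because 4 is in A, and at most 36 because 6 is
   not. *)
have n12 : 12 %| n by rewrite (@Gauss_dvd 4 3) // rn qn.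
have n_gt16 : 16 < n.
  by have := ap_mem 2 k_gt2; rewrite pE aE => /(small_divisorsP n_gt0)[].
have : n <= 6 ^ 2.
  apply: leq_sqr_notin_small_divisors => //; first exact: dvdn_trans n12.
  by apply/negP=> /ap_leq; rewrite pE aE k3.
by case/dvdnP: n12 n_gt16 => j ->; lia.
Qed.
End Shape.

(** * Assembly of the twelve cases by the number of small divisors *)

Lemma mem_ap_fset (p a k x : nat) :
  (x \in [fset p + i * a | i in iota 0 k])
  = (x \in [seq p + i * a | i <- iota 0 k]).
Proof. by apply/imfsetP/mapP => -[i ik ->]; exists i. Qed.

Theorem theorem1p1 (n : nat) (n_ge2 : 2 <= n)
    (AP : in_arith_progression (small_divisors n)) :
  #|` small_divisors n| <= 5 /\
  ((exists p : nat, prime p /\ (n = p \/ n = p ^ 2) /\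
      small_divisors n = fset0)
   \/ (exists p q : nat, prime p /\ prime q /\ p < q /\ n = p * q /\
      small_divisors n = [fset p])
   \/ (exists p : nat, prime p /\ (n = p ^ 3 \/ n = p ^ 4) /\
      small_divisors n = [fset p])
   \/ (exists p : nat, prime p /\ n = p ^ 5 /\
      small_divisors n = [fset p; p ^ 2])
   \/ (exists p q : nat, prime p /\ prime q /\ p < q /\ n = p * q ^ 2 /\
      small_divisors n = [fset p; q])
   \/ (exists p q : nat, prime p /\ prime q /\ p ^ 2 < q /\ n = p ^ 2 * q /\
      small_divisors n = [fset p; p ^ 2])
   \/ (exists p q : nat, prime p /\ prime q /\ p < q /\ q < p ^ 2 /\
      n = p ^ 2 * q /\ small_divisors n = [fset p; q])
   \/ (exists p : nat, prime p /\ n = p ^ 6 /\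
      small_divisors n = [fset p; p ^ 2])
   \/ (n = 36 /\ small_divisors n = [fset 2; 3; 4])
   \/ (exists p q r : nat, prime p /\ prime q /\ prime r /\ p < q /\ q < r /\
      2 * q = p + r /\ n = p * q * r /\ small_divisors n = [fset p; q; r])
   \/ (n = 24 /\ small_divisors n = [fset 2; 3; 4])
   \/ (n = 60 /\ small_divisors n = [fset 2; 3; 4; 5; 6])).
Proof.
have n_gt0 := ltnW n_ge2; case: AP => p [a [a_gt0]].
have [k kE] : exists k, k = #|` small_divisors n|.
  by exists #|` small_divisors n|.
rewrite -kE => An; have H := small_divisors_apI n_gt0 a_gt0 An.
have [k_gt3|] := ltnP 3 k.
  have [k5 p2 a1 nE] := ap_long H k_gt3; subst k p a; rewrite k5 in An *.
  split=> //; do 11 right; split=> //; rewrite An; apply/fsetP=> x.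
  by rewrite mem_ap_fset !inE /= !orbA.
case: k kE H An => [|[|[|[|//]]]] kE H An _; split=> //.
- have /eqP An0 : small_divisors n == fset0 by rewrite -cardfs_eq0 -kE.
  have [q qp nE] := small_divisors_fset0 n_ge2 An0.
  by left; exists q.
- have {}An : small_divisors n = [fset p].
    by apply/fsetP=> x; rewrite An mem_ap_fset !inE /= mul0n addn0.
  have [pp [[q [qp pq nE]]|nE]] := small_divisors_fset1 n_ge2 An.
    by right; left; exists p, q.
  by do 2 right; left; exists p.
- have {}An : small_divisors n = [fset p; p + a].
    by apply/fsetP=> x; rewrite An mem_ap_fset !inE /= mul0n mul1n addn0.
  have p_lt : p < p + a by rewrite -addn1 leq_add2l.
  have [pp] := small_divisors_fset2 n_ge2 p_lt An.
  set x := p + a in An p_lt *.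
  case=> [[xE [nE|nE]]|[xE [q [qp pq nE]]]|[xp nE]|[xp xlt nE]].
  + by do 3 right; left; exists p; rewrite -xE.
  + by do 7 right; left; exists p; rewrite -xE.
  + by do 5 right; left; exists p, q; rewrite xE in An.
  + by do 4 right; left; exists p, x.
  + by do 6 right; left; exists p, x.
have [[p2 [a1 nE]]|[pp qp rp nE]] := ap_three H erefl.
  have {}An : small_divisors n = [fset 2; 3; 4].
    by apply/fsetP=> x; rewrite An mem_ap_fset p2 a1 !inE /= !orbA.
  by case: nE => nE; [do 10 right | do 8 right]; left.
have {}An : small_divisors n = [fset p; p + a; p + 2 * a].
  by apply/fsetP=> x; rewrite An mem_ap_fset !inE /= mul0n mul1n addn0 !orbA.
do 9 right; left; exists p, (p + a), (p + 2 * a).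
do !split=> //; lia.
Qed.
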